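(* Let $\mathcal A$ be a van Hove sequence in $G$, let $p,q\in(1,\infty)$ with $\frac1p+\frac1q=1$, and let $f\in BL^p_{\mathcal A}(G)\cap L^\infty(G)$ and $g\in \mathrm{Map}^q_{\mathcal A}(G)\cap L^\infty(G)$. If the twisted Eberlein convolution $[f,g]_{\mathcal A}$ exists, then $[f,g]_{\mathcal A}\in SAP(G)$.
   Context: $G$ is a second countable, locally compact (Hausdorff) Abelian group with Haar measure $|\cdot|$. A van Hove sequence is a sequence $\mathcal A=(A_n)_{n\in\mathbb N}$ of precompact open subsets of $G$ (of positive measure) such that $\lim_{n}|\partial^K A_n|/|A_n|=0$ for each compact $K\subseteq G$, where for open $A$, $\partial^K A:=(\overline{A+K}\setminus A)\cup(((G\setminus A)-K)\cap\overline A)$. For measurable $f,g:G\to\mathbb C$, the twisted Eberlein convolution $[f,g]_{\mathcal A}$ is the function on $G$ given by $[f,g]_{\mathcal A}(t)=\lim_{n\to\infty}\frac1{|A_n|}\int_{A_n}f(s)\overline{g(s-t)}\,ds$; it is said to exist if this limit exists for all $t\in G$. For $1\le p<\infty$ and $f\in L^p_{\mathrm{loc}}(G)$, $\|f\|_{b,p,\mathcal A}=(\limsup_{n}\frac1{|A_n|}\int_{A_n}|f(t)|^p\,dt)^{1/p}$, $BL^p_{\mathcal A}(G)=\{f\in L^p_{\mathrm{loc}}(G):\|f\|_{b,p,\mathcal A}<\infty\}$, and $BC^p_{\mathcal A}(G)$ is the closure of $C_u(G)$ (bounded uniformly continuous functions) in $BL^p_{\mathcal A}(G)$. With $(\tau_tf)(x)=f(x-t)$,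 $\mathrm{MAP}_{\mathcal A}(G)$ is the set of $f\in C_u(G)$ such that for each $\varepsilon>0$ the set $\{t\in G:\|f-\tau_tf\|_{b,1,\mathcal A}<\varepsilon\}$ is relatively dense, and $\mathrm{Map}^p_{\mathcal A}(G)$ is the closure of $\mathrm{MAP}_{\mathcal A}(G)$ in $BC^p_{\mathcal A}(G)$ with respect to $\|\cdot\|_{b,p,\mathcal A}$. $SAP(G)$ is the set of $f\in C_u(G)$ such that the closure of $\{\tau_tf:t\in G\}$ in $(C_u(G),\|\cdot\|_\infty)$ is compact. *)

(* Defs.v *)
From HB Require Import structures.
From mathcomp Require Import all_boot all_order all_algebra.
From mathcomp Require Import all_classical all_reals all_analysis.
From mathcomp Require Import ess_sup_inf.
From mathcomp.real_closed Require Export complex.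

Set Implicit Arguments.
Unset Strict Implicit.
Unset Printing Implicit Defensive.

Import Order.TTheory GRing.Theory Num.Theory.
Import numFieldNormedType.Exports.

Local Open Scope classical_set_scope.
Local Open Scope complex_scope.
Local Open Scope ring_scope.

(* The library puts a sigma-algebra on g_sigma_algebraType only over a
   pointedType; a zmodType is one (pointed at 0), a topologicalZmodType is not. *)
Notation borel G :=
  (@g_sigma_algebraType (G%type : zmodType) (@open G%type)).

Notation normc := Normc.normc.

(* Regularity is not required: on a second countable locally compact Hausdorff
   space every Borel measure that is finite on compact sets is regular. *)
Definition is_haar (R : realType) (G : topologicalZmodType)
    (mu : {measure set (borel G) -> \bar R}) : Prop :=
  [/\ mu setT != 0%E,
      forall K : set G, compact K -> (mu K < +oo)%E &
      forall (t : G) (B : set (borel G)), measurable B ->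
        mu [set t + x | x in (B : set G)] = mu B].

Section basic_notions.
Context {R : realType} {G : topologicalZmodType}.
Implicit Types (A K S : set G) (f g : G -> R[i]).

Definition translate (t : G) f : G -> R[i] := fun x => f (x - t).

Definition minkowski_add (A K : set G) : set G := [set a + k | a in A & k in K].
Definition minkowski_sub (A K : set G) : set G := [set a - k | a in A & k in K].

Definition vh_boundary K A : set G :=
  (closure (minkowski_add A K) `\` A) `|`
  (minkowski_sub (~` A) K `&` closure A).

Definition relatively_dense S : Prop :=
  exists2 K, compact K & minkowski_add S K = setT.

(* Uniform continuity refers to the translation-invariant uniformity of G. *)
Definition Cu : set (G -> R[i]) :=
  [set f | (exists M : R, forall x, normc (f x) <= M) /\
           (forall e : R, 0 < e ->
              \forall u \near (0 : G), forall x, normc (f (x + u) - f x) < e)].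

(* On Cu, the topology of {uniform G -> C} is the one of the sup norm. *)
Definition SAP : set (G -> R[i]) :=
  [set f | Cu f /\
     compact (closure (range (translate^~ f) : set {uniform G -> R[i]^o})
              `&` (Cu : set {uniform G -> R[i]^o}))].

(* Classes modulo null sets are represented by everywhere defined Borel
   functions; every Haar measurable function has a Borel representative, as G
   is sigma-compact. *)
Definition cmeasurable f : Prop :=
  measurable_fun [set: borel G] (fun x : borel G => complex.Re (f x)) /\
  measurable_fun [set: borel G] (fun x : borel G => complex.Im (f x)).

End basic_notions.

Section besicovitch.
Context {R : realType} {G : topologicalZmodType}.
Variable mu : {measure set (borel G) -> \bar R}.
Variable A : nat -> set G.
Implicit Types (f g h : G -> R[i]) (p : R).

Definition van_hove : Prop :=
  (forall n, [/\ open (A n), precompact (A n) & (0 < mu (A n))%E]) /\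
  (forall K : set G, compact K ->
     (fun n => (mu (vh_boundary K (A n)) / mu (A n))%E) @ \oo --> 0%E).

Definition cintegral (D : set G) f : R[i] :=
  (\int[mu]_(x in D) complex.Re (f x)) +i* (\int[mu]_(x in D) complex.Im (f x)).

(* R[i]^o is the copy of the complex numbers that carries the norm topology. *)
Definition eberlein_mean f g (t : G) (n : nat) : R[i]^o :=
  ((fine (mu (A n)))^-1)%:C * cintegral (A n) (fun s => f s * conjc (g (s - t))).

Definition twisted_eberlein_exists f g : Prop :=
  forall t : G, cvgn (eberlein_mean f g t).

Definition twisted_eberlein f g : G -> R[i] :=
  fun t => limn (eberlein_mean f g t).

Definition Linfty : set (G -> R[i]) :=
  [set f | cmeasurable f /\
           (ess_sup mu (fun x : borel G => (normc (f x))%:E) < +oo)%E].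

Definition Lploc p : set (G -> R[i]) :=
  [set f | cmeasurable f /\ forall K : set G, compact K ->
     (\int[mu]_(x in (K : set (borel G))) (normc (f x) `^ p)%R%:E < +oo)%E].

Definition bnorm p f : \bar R :=
  (limn_esup (fun n =>
     (\int[mu]_(x in (A n : set (borel G))) (normc (f x) `^ p)%R%:E) / mu (A n))
   `^ p^-1)%E.

Definition BL p : set (G -> R[i]) := [set f | Lploc p f /\ (bnorm p f < +oo)%E].

(* Closure of F in S for the bnorm p seminorm. *)
Definition bclosure p (F S : set (G -> R[i])) : set (G -> R[i]) :=
  [set f | S f /\ forall e : R, 0 < e ->
     exists2 h, F h & (bnorm p (f \- h)%R < e%:E)%E].

Definition BC p : set (G -> R[i]) := bclosure p Cu (BL p).

Definition MAP : set (G -> R[i]) :=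
  [set f | Cu f /\ forall e : R, 0 < e ->
     relatively_dense [set t | (bnorm 1 (f \- translate t f)%R < e%:E)%E]].

Definition Map p : set (G -> R[i]) := bclosure p MAP (BC p).

End besicovitch.

(* Main.v *)
(* Since f is essentially bounded by M, the convolution F = [f, g] satisfies
     |F(t + u) - F(t)| <= 2 M limsup mean_{A_n} |g(. - t - u) - g(. - t)|,
   and the van Hove property makes the means of bounded functions asymptotically
   translation invariant.  Replacing g by a nearby h in MAP therefore bounds the
   left-hand side, uniformly in t, by a small multiple of eps plus a multiple of
   the mean of |h - h(. - u)|.  Hence F inherits from h both uniform continuity
   and a relatively dense set of almost periods for the sup norm, and Bohr's
   condition implies Bochner's: the translates of F by a compact set of
   parameters are eps-dense among all translates. *)

Require Import Defs.
From HB Require Import structures.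
From mathcomp Require Import all_boot all_order all_algebra.
From mathcomp Require Import all_classical all_reals all_analysis.
From mathcomp Require Import ess_sup_inf measurable_realfun.
From mathcomp Require Import ring lra.

Set Implicit Arguments.
Unset Strict Implicit.
Unset Printing Implicit Defensive.

Import Order.TTheory GRing.Theory Num.Theory.
Import numFieldNormedType.Exports.

Local Open Scope classical_set_scope.
Local Open Scope ring_scope.

(** * The real-valued modulus of complex numbers *)

Section ComplexNorm.
Context {R : realType}.
Implicit Types x y z : R[i].

Lemma normc_ge0 x : 0 <= normc x.
Proof. by case: x => a b; exact: sqrtr_ge0. Qed.

Lemma normc_addr x y : normc (x + y) <= normc x + normc y.
Proof. exact: le_normcD. Qed.

Lemma normc_distC x y : normc (x - y) = normc (y - x).
Proof. by rewrite -(@normcN R (x - y)); congr normc; exact: opprB. Qed.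

Lemma normc_dist_add y x z : normc (x - z) <= normc (x - y) + normc (y - z).
Proof. by apply: le_trans (normc_addr _ _); rewrite addrA subrK. Qed.

Lemma normc_conjc x : normc (conjc x) = normc x.
Proof. by case: x => a b /=; rewrite sqrrN. Qed.

Lemma normc_real (a : R) : normc (a%:C)%C = `|a|.
Proof. by rewrite /= expr0n/= addr0 sqrtr_sqr. Qed.

Lemma conjcB x y : conjc (x - y) = conjc x - conjc y.
Proof.
by case: x => a b; case: y => c d /=; congr (_ +i* _)%C; rewrite opprD.
Qed.

Lemma normRe_le_normc x : `|complex.Re x| <= normc x.
Proof.
case: x => a b /=; rewrite -sqrtr_sqr ler_wsqrtr//.
by rewrite lerDl sqr_ge0.
Qed.

Lemma normIm_le_normc x : `|complex.Im x| <= normc x.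
Proof.
case: x => a b /=; rewrite -sqrtr_sqr ler_wsqrtr//.
by rewrite lerDr sqr_ge0.
Qed.

Lemma normc_le_ReIm x : normc x <= `|complex.Re x| + `|complex.Im x|.
Proof.
case: x => a b /=.
rewrite -[leRHS]ger0_norm ?addr_ge0// -sqrtr_sqr ler_wsqrtr//.
rewrite sqrrD !real_normK ?num_real// lerD2r lerDl.
by rewrite mulrn_wge0// mulr_ge0.
Qed.

Lemma complex_ballE x (e : R) y :
  ball (x : R[i]^o) (e%:C)%C y = (normc (x - y) < e) :> Prop.
Proof.
rewrite -ball_normE /ball_ /=.
by rewrite -[`|_|]/((normc (x - y))%:C)%C ltcR.
Qed.

Lemma complex_gt0 (e : R[i]) : 0 < e -> exists2 d : R, 0 < d & e = (d%:C)%C.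
Proof. by case: e => a b; rewrite ltcE/= => /andP[/eqP -> a0]; exists a. Qed.

End ComplexNorm.

(** * Almost periodicity in the senses of Bohr and Bochner *)

Section BohrAlmostPeriodic.
Context {R : realType} {G : topologicalZmodType}.
Implicit Types (F : G -> R[i]).

(** The radius of a ball in [R[i]^o] is itself a complex number; positivity forces it to be real, so
    balls of real radius already generate the uniformity. *)
Lemma nbhs_uniform_normc (phi : {uniform G -> R[i]^o})
    (P : set {uniform G -> R[i]^o}) :
  nbhs phi P <-> exists2 e : R, 0 < e &
    [set psi : {uniform G -> R[i]^o} |
      forall x, normc (phi x - psi x) < e] `<=` P.
Proof.
split=> [/uniform_nbhs[E [entE EP]]|[e e0 eP]].
  move: entE; rewrite -entourage_from_ballE => -[d /= d0 dE].
  have [e e0 de] := @complex_gt0 R d d0; exists e => // psi psie.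
  by apply: EP => x _; apply: dE => /=; rewrite de complex_ballE.
apply/uniform_nbhs; exists [set xy | ball xy.1 (e%:C)%C xy.2]; split.
  by rewrite -entourage_from_ballE; exists (e%:C)%C => //=; rewrite ltcR.
by move=> psi psie; apply: eP => x; have := psie x I; rewrite /= complex_ballE.
Qed.

Definition unif_cont F := forall e : R, 0 < e ->
  \forall u \near (0 : G), forall x, normc (F (x + u) - F x) < e.

Definition bohr_periodic F := forall e : R, 0 < e ->
  relatively_dense [set t | forall x, normc (F (x - t) - F x) < e].

Lemma near_subr (k : G) (P : set G) : (\forall u \near (0 : G), P u) ->
  \forall k' \near k, P (k - k').
Proof.
move=> P0.
have c : {for k, continuous (fun k' : G => k - k')}.
  apply: (@continuous_comp _ _ _ (fun k' => (k, k'))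
    (fun x : G * G => x.1 - x.2)).
    by apply: cvg_pair => /=; [exact: cvg_cst|exact: cvg_id].
  exact: sub_continuous.
by apply: c; rewrite subrr.
Qed.

(** Uniform continuity and compactness bound [F] on [- K], and an almost period moves any point into
    [- K] at a cost of at most 1. *)
Lemma bohr_Cu F : unif_cont F -> bohr_periodic F -> Cu F.
Proof.
move=> ucF apF; split=> //.
have [K Kc KS] := apF 1 ltr01.
(* Near-covering form of compactness, with [M] tending to infinity: local bounds on [K] merge into a
   single one. *)
have bK : \forall M \near +oo, K `<=` (fun k => normc (F (- k)) <= M).
  apply: ((compact_near_coveringP K).1 Kc R) => k Kk.
  have nk := near_subr k (ucF 1 ltr01).

  exists ([set k' | forall x, normc (F (x + (k - k')) - F x) < 1],
    [set M | normc (F (- k)) + 1 <= M]) => /=.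
    by split=> //; apply: nbhs_pinfty_ge; exact: num_real.
  move=> [k' M]/= [/(_ (- k)) k'k kM]; apply: le_trans kM.
  rewrite addKr in k'k.
  rewrite -lerBlDl; apply: ltW; apply: le_lt_trans k'k.
  by rewrite lerBlDr -{1}[F (- k')](subrK (F (- k))) normc_addr.
have [M KM] := filter_ex bK.
exists (M + 1) => x.
have : [set: G] (- x) by [].
rewrite -KS => -[s sS [k Kk skx]].
have -> : x = - k - s by rewrite -opprD addrC skx opprK.
have := sS (- k) => /= /ltW sk.
rewrite [M + 1]addrC -[F (- k - s)](subrK (F (- k))).
apply: le_trans (normc_addr _ _) _; apply: lerD => //; exact: KM.
Qed.

(** An ultrafilter [U] on the closure is Cauchy for the sup norm ([totb]), its pointwise limit [phi]
    is a uniform limit ([Uphi]), and membership in the closure and in [Cu] passes to [phi]. *)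
Lemma bohr_SAP F : unif_cont F -> bohr_periodic F -> SAP F.
Proof.
move=> ucF apF; split; first exact: bohr_Cu.
set S := range (translate^~ F).
rewrite compact_ultra => U UU US.
have Ucl : U (closure (S : set {uniform G -> R[i]^o})).
  by apply: filterS US => psi [].
have UCu : U (Cu : set {uniform G -> R[i]^o}) by apply: filterS US => psi [].
pose B (e : R) k : set {uniform G -> R[i]^o} :=
  [set psi | forall x, normc (psi x - F (x - k)) < e].
(* Otherwise each psi avoids a ball around translate k F for every k in K,
   uniformly over the compact K, whereas these balls cover [closure S]. *)
have totb e : 0 < e -> exists k, U (B e k).
  move=> e0; have e2 : 0 < e / 2 by rewrite divr_gt0.
  have e4 : 0 < e / 2 / 2 by rewrite divr_gt0.
  have [K Kc KS] := apF _ e4.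
  apply: contrapT => noB.
  have UK : \forall psi \near U, K `<=` (fun k => ~ B (e / 2) k psi).
    apply: ((compact_near_coveringP K).1 Kc) => k Kk.
    have nB : U (~` B e k).
      have [BU|//] := in_ultra_setVsetC (B e k) UU.
      by case: noB; exists k.
    have nk := near_subr k (ucF _ e2).
    exists ([set k' | forall x, normc (F (x + (k - k')) - F x) < e / 2],
      ~` B e k) => //=.
    move=> [k' psi]/= [k'k npsi] psik'; apply: npsi => x.
    rewrite [e]splitr.
    apply: le_lt_trans (normc_dist_add (F (x - k')) _ _) _.
    apply: ltrD; first exact: psik'.
    by have := k'k (x - k); rewrite addrA subrK.
  have [psi [clpsi Kpsi]] := filter_ex (filterI Ucl UK).
  have nb : nbhs psi [set psi' | forall x, normc (psi x - psi' x) < e / 2 / 2].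
    by apply/nbhs_uniform_normc; exists (e / 2 / 2).
  have [_ [[t _ <-] /= tpsi]] := clpsi _ nb.
  (* With t = s + k, the translates of [F] by t and by k differ by less than e / 4, so [psi] lies in
     the ball of radius e / 2 that [Kpsi] excludes. *)
  have : [set: G] t by [].
  rewrite -KS => -[s sS [k Kk skt]].
  apply: (Kpsi k Kk) => x.
  rewrite [e / 2]splitr.
  apply: le_lt_trans (normc_dist_add (F (x - t)) _ _) _.
  apply: ltrD; first exact: tpsi.
  by have := sS (x - k); rewrite -skt opprD addrA addrAC.
(* By [totb], [U] is Cauchy at every point [x]; completeness of [R] yields limits of the real and
   imaginary parts. *)
have ReU x : cvg ((fun psi : {uniform G -> R[i]^o} => complex.Re (psi x)) @ U).
  apply: cauchy_cvg; apply: cauchy_exP => e e0.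
  have [k Bk] := totb e e0.
  exists (complex.Re (F (x - k))).
  suff : U [set psi : {uniform G -> R[i]^o} |
    ball (complex.Re (F (x - k))) e (complex.Re (psi x))] by [].
  apply: filterS Bk => psi /(_ x) psik /=.
  rewrite -ball_normE /ball_/= distrC; apply: le_lt_trans psik.
  by rewrite (_ : _ - _ = complex.Re (psi x - F (x - k))) ?normRe_le_normc//;
    case: (psi x) => ? ?; case: (F _).
have ImU x : cvg ((fun psi : {uniform G -> R[i]^o} => complex.Im (psi x)) @ U).
  apply: cauchy_cvg; apply: cauchy_exP => e e0.
  have [k Bk] := totb e e0.
  exists (complex.Im (F (x - k))).
  suff : U [set psi : {uniform G -> R[i]^o} |
    ball (complex.Im (F (x - k))) e (complex.Im (psi x))] by [].
  apply: filterS Bk => psi /(_ x) psik /=.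
  rewrite -ball_normE /ball_/= distrC; apply: le_lt_trans psik.
  by rewrite (_ : _ - _ = complex.Im (psi x - F (x - k))) ?normIm_le_normc//;
    case: (psi x) => ? ?; case: (F _).
pose phi : {uniform G -> R[i]^o} := fun x =>
  (lim ((fun psi : {uniform G -> R[i]^o} => complex.Re (psi x)) @ U) +i*
   lim ((fun psi : {uniform G -> R[i]^o} => complex.Im (psi x)) @ U))%C.
have phi_ptws x e : 0 < e ->
    U [set psi : {uniform G -> R[i]^o} | normc (psi x - phi x) < e].
  move=> e0; have e2 : 0 < e / 2 by rewrite divr_gt0.
  have Rx : U [set psi : {uniform G -> R[i]^o} |
      `|complex.Re (phi x) - complex.Re (psi x)| < e / 2].
    by have /cvgrPdist_lt := ReU x; exact.
  have Ix : U [set psi : {uniform G -> R[i]^o} |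
      `|complex.Im (phi x) - complex.Im (psi x)| < e / 2].
    by have /cvgrPdist_lt := ImU x; exact.
  apply: filterS2 Rx Ix => psi Rx Ix /=.
  apply: le_lt_trans (normc_le_ReIm _) _.
  rewrite [e]splitr; apply: ltrD.
    by move: Rx; rewrite /= distrC /phi; case: (psi x).
  by move: Ix; rewrite /= distrC /phi; case: (psi x).
have Uphi e : 0 < e ->
    U [set psi : {uniform G -> R[i]^o} | forall x, normc (phi x - psi x) < e].
  move=> e0; have e4 : 0 < e / 2 / 2 by rewrite !divr_gt0.
  have [k Bk] := totb _ e4.
  apply: filterS (Bk) => psi psik x.
  have e8 : 0 < e / 2 by rewrite divr_gt0.
  (* The auxiliary [psi'] depends on [x], but it and [psi] are both within e / 4 of the same
     translate of [F], so the resulting bound is uniform in [x]. *)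
  have [psi' [/= psi'k psi'x]] := filter_ex (filterI Bk (phi_ptws x _ e8)).
  rewrite [e]splitr.
  apply: le_lt_trans (normc_dist_add (psi' x) _ _) _.
  rewrite normc_distC ltrD// [e / 2]splitr.
  apply: le_lt_trans (normc_dist_add (F (x - k)) _ _) _.
  by rewrite ltrD// normc_distC.
clearbody phi.
exists phi; split; last first.
  move=> P /nbhs_uniform_normc[e e0 eP].
  by apply: filterS (Uphi e e0) => psi; exact: eP.
split.
  move=> P /nbhs_uniform_normc[e e0 eP].
  have e2 : 0 < e / 2 by rewrite divr_gt0.
  have [psi [psicl psiphi]] := filter_ex (filterI Ucl (Uphi _ e2)).
  have [|psi' [Spsi' /= psi'psi]] := psicl
      [set psi' | forall x, normc (psi x - psi' x) < e / 2].
    by apply/nbhs_uniform_normc; exists (e / 2).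
  exists psi'; split => //; apply: eP => x; rewrite [e]splitr.
  by apply: le_lt_trans (normc_dist_add (psi x) _ _) _; rewrite ltrD.
split.
  have [psi [[[M psiM] _] psiphi]] := filter_ex (filterI UCu (Uphi 1 ltr01)).
  exists (1 + M) => x; rewrite -[phi x](subrK (psi x)).
  by apply: le_trans (normc_addr _ _) _; rewrite lerD// ltW.
move=> e e0; have e3 : 0 < e / 3 by rewrite divr_gt0.
have [psi [[_ /(_ _ e3) ucpsi] /= psiphi]] :=
  filter_ex (filterI UCu (Uphi _ e3)).
apply: filterS ucpsi => u psiu x.
have -> : e = e / 3 + (e / 3 + e / 3) by lra.
apply: le_lt_trans (normc_dist_add (psi (x + u)) _ _) _; rewrite ltrD//.
apply: le_lt_trans (normc_dist_add (psi x) _ _) _; rewrite ltrD//.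
by rewrite normc_distC.
Qed.

End BohrAlmostPeriodic.

(** * Borel measurability of complex functions and of translations *)

Section BorelMeasurability.
Context {R : realType} {G : topologicalZmodType}.
Implicit Types (f g : G -> R[i]) (t : G).

Lemma open_borel_measurable (U : set G) :
  open U -> measurable (U : set (borel G)).
Proof. by move=> oU; exact: sub_sigma_algebra. Qed.

Lemma closed_borel_measurable (C : set G) :
  closed C -> measurable (C : set (borel G)).
Proof.
by move=> cC; rewrite -(setCK C); apply: measurableC;
  apply: open_borel_measurable; exact: closed_openC.
Qed.

Lemma addr_continuous t : continuous (fun x : G => x + t).
Proof.
move=> x; apply: (@continuous_comp _ _ _ (fun x => (x, t))
  (fun x : G * G => x.1 + x.2)).
  by apply: cvg_pair => /=; [exact: cvg_id|exact: cvg_cst].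
exact: add_continuous.
Qed.

Lemma measurable_addr t :
  measurable_fun [set: borel G] (fun x : borel G => (x + t : borel G)).
Proof.
apply: (@measurability _ _ (borel G) (borel G) _ _ (@open G)) => // _ [U oU <-].
rewrite setTI; apply: open_borel_measurable.
by have /continuousP := @addr_continuous t; exact.
Qed.

Lemma continuous_borel_measurable (h : G -> R) :
  continuous h -> measurable_fun [set: borel G] (h : borel G -> R).
Proof.
move=> /continuousP ch; apply: (measurability _ (RGenOpens.measurableE R)).
move=> _ [_ [a [b ->] <-]]; rewrite setTI.
by apply: open_borel_measurable; apply: ch; exact: interval_open.
Qed.

Lemma unif_cont_cmeasurable f : unif_cont f -> cmeasurable f.
Proof.
move=> ucf.
(* [l] stands for the real or the imaginary part: both are additive and dominated by the modulus,
   hence preserve continuity. *)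
have c (l : R[i] -> R) : (forall x, `|l x| <= normc x) ->
    (forall x y, l (x - y) = l x - l y) -> continuous (fun x : G => l (f x)).
  move=> lN lB x; apply/cvgrPdist_lt => e e0.
  have := near_subr x (ucf e e0).
  apply: filterS => k /(_ k); rewrite (addrC k) subrK => xk.
  by rewrite -lB; apply: le_lt_trans xk.
split; apply: continuous_borel_measurable; apply: c.
- exact: normRe_le_normc.
- by move=> [? ?] [? ?].
- exact: normIm_le_normc.
- by move=> [? ?] [? ?].
Qed.

Lemma cmeasurable_normc f : cmeasurable f ->
  measurable_fun [set: borel G] (fun x : borel G => normc (f x)).
Proof.
move=> [fR fI].
rewrite (_ : (fun x => _) =
  Num.sqrt \o (fun x : borel G =>
    complex.Re (f x) ^+ 2 + complex.Im (f x) ^+ 2)).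
  apply: measurableT_comp.
    by apply: continuous_measurable_fun; exact: sqrt_continuous.
  by apply: measurable_funD; apply: measurable_funX.
by apply/funext => x /=; case: (f x).
Qed.

Lemma cmeasurable_translate t f : cmeasurable f -> cmeasurable (translate t f).
Proof.
move=> [fR fI]; split.
  exact: (measurableT_comp fR (measurable_addr (- t))).
exact: (measurableT_comp fI (measurable_addr (- t))).
Qed.

Lemma cmeasurableB f g : cmeasurable f -> cmeasurable g ->
  cmeasurable (fun x => f x - g x).
Proof.
move=> [fR fI] [gR gI]; split.
  rewrite (_ : (fun x => _) = (fun x : borel G =>
      complex.Re (f x) - complex.Re (g x))).
    exact: measurable_funB.
  by apply/funext => x; case: (f x); case: (g x).
rewrite (_ : (fun x => _) = (fun x : borel G =>
      complex.Im (f x) - complex.Im (g x))).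
  exact: measurable_funB.
by apply/funext => x; case: (f x); case: (g x).
Qed.

Lemma cmeasurable_conjc f : cmeasurable f -> cmeasurable (fun x => conjc (f x)).
Proof.
move=> [fR fI]; split.
  by rewrite (_ : (fun x => _) = (fun x : borel G => complex.Re (f x)))//;
    apply/funext => x; case: (f x).
rewrite (_ : (fun x => _) = (fun x : borel G => - complex.Im (f x))).
  exact: measurable_funN.
by apply/funext => x; case: (f x).
Qed.

Lemma cmeasurableM f g : cmeasurable f -> cmeasurable g ->
  cmeasurable (fun x => f x * g x).
Proof.
move=> [fR fI] [gR gI]; split.
  rewrite (_ : (fun x => _) = (fun x : borel G =>
      complex.Re (f x) * complex.Re (g x) -
      complex.Im (f x) * complex.Im (g x))).
    by apply: measurable_funB; exact: measurable_funM.
  by apply/funext => x; case: (f x); case: (g x).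
rewrite (_ : (fun x => _) = (fun x : borel G =>
    complex.Re (f x) * complex.Im (g x) + complex.Im (f x) * complex.Re (g x))).
  by apply: measurable_funD; exact: measurable_funM.
by apply/funext => x; case: (f x); case: (g x).
Qed.

End BorelMeasurability.

(* Stands in for Hoelder's inequality when passing from [bnorm q] to a bound on
   plain means: integrating it gives [2 * d] when the mean of [x `^ q] is at
   most [d `^ q]. *)
Lemma le_add_powR {R : realType} (q d x : R) : 1 <= q -> 0 < d -> 0 <= x ->
  x <= d + (d `^ (q - 1))^-1 * x `^ q.
Proof.
move=> q1 d0 x0.
have q0 : 0 < q by apply: lt_le_trans q1.
have dq0 : 0 < d `^ (q - 1) by exact: powR_gt0.
have [xd|dx] := leP x d.
  by rewrite (le_trans xd)// lerDl mulr_ge0 ?powR_ge0// invr_ge0 ltW.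
rewrite -(mulr_powRB1 x0 q0) mulrCA.
rewrite (@le_trans _ _ (x * ((d `^ (q - 1))^-1 * x `^ (q - 1))))//; last first.
  by rewrite lerDr ltW.
rewrite -[leLHS]mulr1 ler_wpM2l// ler_pdivlMl// mulr1.
by rewrite ge0_ler_powR ?subr_ge0// ?nnegrE ?ltW// (lt_trans d0).
Qed.

(** The limsup is an infimum of suprema over neighbourhoods of infinity, and one of these suprema is
    already below [c]. *)
Lemma limn_esup_lt {R : realType} (u : (\bar R)^nat) (c : \bar R) :
  (limn_esup u < c)%E ->
  \forall n \near \oo, (u n < c)%E.
Proof.
move=> /ereal_inf_lt[_ [V nV <-] Vc]; apply: filterS nV => n Vn.
by apply: le_lt_trans Vc; apply: ereal_sup_ubound; exists n.
Qed.

(* The library's hint for this instance does not unify through [borel G]. *)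
#[local] Instance borel_ae_filter {R : realType} {G : topologicalZmodType}
    (mu : {measure set (borel G) -> \bar R}) :
  Filter (nbhs (almost_everywhere mu)).
Proof. exact: (@ae_filter_ringOfSetsType _ (borel G) R mu). Qed.

(** * Haar integrals and means along the van Hove sequence *)

Section Means.
Context {R : realType} {G : topologicalZmodType}.
Variable mu : {measure set (borel G) -> \bar R}.
Variable A : nat -> set G.
Hypothesis mu_haar : is_haar mu.
Hypothesis A_van_hove : van_hove mu A.
Implicit Types (phi psi : G -> R) (f g h k : G -> R[i]) (t u : G).

Local Notation An n := (A n : set (borel G)).

Lemma vh_measurable n : measurable (An n).
Proof. by apply: open_borel_measurable; have [] := A_van_hove.1 n. Qed.

Lemma vh_gt0 n : (0 < mu (A n))%E.
Proof. by have [] := A_van_hove.1 n. Qed.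

Lemma vh_fin n : mu (A n) \is a fin_num.
Proof.
have [oA pA A0] := A_van_hove.1 n; have [_ Kfin _] := mu_haar.
rewrite ge0_fin_numE ?ltW//; apply: le_lt_trans (Kfin (closure (A n)) _).
  apply: le_measure; rewrite ?inE.
  - exact: vh_measurable.
  - by apply: closed_borel_measurable; exact: closed_closure.
  - exact: subset_closure.
by rewrite -precompactE.
Qed.

Lemma vh_EFin n : mu (A n) = (fine (mu (A n)))%:E.
Proof. by rewrite fineK// vh_fin. Qed.

Lemma fine_vh_gt0 n : 0 < fine (mu (A n)).
Proof. by rewrite -lte_fin -vh_EFin vh_gt0. Qed.

Lemma haar_preimage t (B : set (borel G)) : measurable B ->
  mu [set x | B (x - t)] = mu B.
Proof.
have [_ _ inv] := mu_haar => mB; rewrite -(inv t _ mB); congr (mu _).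
apply/seteqP; split => [x Bx|_ [x Bx <-]] /=; last by rewrite addrC addKr.
by exists (x - t) => //; rewrite addrC subrK.
Qed.

(** By invariance, the pushforward of [mu] under subtraction of [t] is [mu] again; this is the
    change of variables for non-negative functions. *)
Lemma integral_translate t (E : set (borel G)) phi :
  measurable E -> measurable_fun [set: borel G] phi -> (forall x, 0 <= phi x) ->
  (\int[mu]_(x in [set x | E (x - t)%R]) (phi (x - t)%R)%:E =
   \int[mu]_(x in E) (phi x)%:E)%E.
Proof.
move=> mE mphi phi0.
have mt := @measurable_addr G (- t).
rewrite -[LHS]/(\int[mu]_(x in (fun x : borel G => (x - t)%R : borel G) @^-1` E)
   (((EFin \o phi) : borel G -> \bar R) \o
    (fun x : borel G => (x - t)%R : borel G)) x)%E.
rewrite -(ge0_integral_pushforward mt)//.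
- by apply: eq_measure_integral => B mB _; exact: haar_preimage.
- by apply: measurable_funTS; exact/measurable_EFinP.
- by move=> x _; rewrite lee_fin.
Qed.

Lemma ae_translate t (P : G -> Prop) :
  (\forall x \ae mu, P x) -> \forall x \ae mu, P (x - t).
Proof.
move=> [N [mN N0 PN]]; exists [set x | N (x - t)]; split.
- have := @measurable_addr G (- t) measurableT N mN.
  by rewrite setTI.
- by rewrite haar_preimage.
- by move=> x /= nP; apply: PN.
Qed.

(** An eventual bound replaces the limsup of the means, and multiplication by [mu (A n)] replaces
    division; such bounds can be added and compared without discussing limits. *)
Definition mean_le phi (c : R) :=
  \forall n \near \oo, (\int[mu]_(x in An n) (phi x)%:E <= c%:E * mu (A n))%E.

Lemma mean_le_mono phi psi c : measurable_fun [set: borel G] phi ->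
  measurable_fun [set: borel G] psi -> (forall x, 0 <= phi x <= psi x) ->
  mean_le psi c -> mean_le phi c.
Proof.
move=> mphi mpsi le_phi; apply: filterS => n; apply: le_trans.
apply: ge0_le_integral.
- exact: vh_measurable.
- by move=> x _; rewrite lee_fin; have /andP[] := le_phi x.
- by apply: measurable_funTS; exact/measurable_EFinP.
- by apply: measurable_funTS; exact/measurable_EFinP.
- by move=> x _; rewrite lee_fin; have /andP[] := le_phi x.
Qed.

Lemma mean_leD phi psi c d : measurable_fun [set: borel G] phi ->
  measurable_fun [set: borel G] psi ->
  (forall x, 0 <= phi x) -> (forall x, 0 <= psi x) ->
  mean_le phi c -> mean_le psi d -> mean_le (fun x => phi x + psi x) (c + d).
Proof.
move=> mphi mpsi phi0 psi0; apply: filterS2 => n phic psid.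
under eq_integral do rewrite EFinD.
rewrite ge0_integralD//.
- rewrite EFinD muleDl ?vh_fin ?fin_num_adde_defl//; exact: leeD.
- exact: vh_measurable.
- by move=> x _; rewrite lee_fin.
- by apply: measurable_funTS; exact/measurable_EFinP.
- by move=> x _; rewrite lee_fin.
- by apply: measurable_funTS; exact/measurable_EFinP.
Qed.

Lemma mean_le_cst c : mean_le (cst c) c.
Proof.
by near=> n; rewrite -(integral_cst mu (vh_measurable n) c%:E).
Unshelve. all: end_near. Qed.

(** For a singleton, the second piece involves a translate of the closed complement of [A n], so
    both pieces are Borel. *)
Lemma vh_boundary1_measurable t n :
  measurable (vh_boundary [set t] (A n) : set (borel G)).
Proof.
have [oA _ _] := A_van_hove.1 n.
apply: measurableU.
  apply: measurableD; last exact: vh_measurable.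
  by apply: closed_borel_measurable; exact: closed_closure.
apply: measurableI; last by apply: closed_borel_measurable; exact: closed_closure.
rewrite (_ : minkowski_sub _ _ = [set x | (~` A n) (x + t)]).
  apply: closed_borel_measurable.
  have /continuous_closedP := @addr_continuous G t.
  by apply; exact: open_closedC.
apply/seteqP; split => [_ [x Ax [_ -> <-]]|x Ax] /=; first by rewrite subrK.
by exists (x + t) => //; exists t => //; rewrite addrK.
Qed.

(** The integral of the translate over [A n] is that of [phi] over [A n] shifted by [- t]. What
    sticks out of [A n] lies in the van Hove boundary for the singleton of [- t], whose relative
    measure tends to 0; as [phi] is essentially bounded, it contributes at most [e]. *)
Lemma mean_le_translate phi c t M e : measurable_fun [set: borel G] phi ->
  (forall x, 0 <= phi x) -> (\forall x \ae mu, phi x <= M) -> 0 < e ->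
  mean_le phi c -> mean_le (fun x => phi (x - t)) (c + e).
Proof.
move=> mphi phi0 phiM e0 phic.
(* The maximum with 1 makes the bound positive, so that the relative boundary measure can be
   required to be below [e / M']. *)
pose M' := Num.max M 1.
have M'0 : 0 < M' by rewrite lt_max ltr01 orbT.
have phiM' : \forall x \ae mu, phi x <= M'.
  by apply: filterS phiM => x; rewrite /M' le_max => ->.
have bd0 := A_van_hove.2 _ (@compact_set1 _ (- t)).
move/fine_cvgP : bd0 => [bd_fin /cvgrPdist_lt/(_ (e / M') (divr_gt0 e0 M'0))] bd_lt.
apply: filterS3 phic bd_fin bd_lt => n phic bd_fin /=.
rewrite sub0r normrN => /(le_lt_trans (ler_norm _)).
rewrite -lte_fin fineK// [X in (_ / X)%E]vh_EFin inver gt_eqF ?fine_vh_gt0//.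
rewrite lte_pdivrMr ?fine_vh_gt0// -vh_EFin => bd_lt.
pose D := [set x | A n (x + t)] : set (borel G).
have mD : measurable D.
  have := @measurable_addr G t measurableT _ (vh_measurable n).
  by rewrite setTI.
rewrite [X in (\int[mu]_(x in X) _)%E](_ : _ = [set x | D (x - t)]); last first.
  by apply/seteqP; split => x; rewrite /D/= subrK.
rewrite integral_translate//.
have mphiE B : measurable_fun B (EFin \o phi : borel G -> \bar R).
  by apply: measurable_funTS; exact/measurable_EFinP.
have mDA : measurable (D `\` An n) by apply: measurableD => //; exact: vh_measurable.
have DbdA : D `\` An n `<=` vh_boundary [set - t] (A n).
  move=> x [Dx nAx]; left; split => //; apply: subset_closure.
  by exists (x + t) => //; exists (- t) => //; rewrite addrK.
apply: (@le_trans _ _ (\int[mu]_(x in An n `|` (D `\` An n)) (phi x)%:E)%E).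
  apply: ge0_subset_integral => //.
  - by apply: measurableU => //; exact: vh_measurable.
  - by move=> x _; rewrite lee_fin.
  - by move=> x Dx; have [Ax|nAx] := pselect (An n x); [left|right].
rewrite ge0_integral_setU//; last 3 first.
- exact: vh_measurable.
- by move=> x _; rewrite lee_fin.
- by apply/disj_setPS => x [Ax [_ /(_ Ax)]].
rewrite EFinD muleDl ?vh_fin ?fin_num_adde_defl// leeD//.
apply: (@le_trans _ _ (\int[mu]_(x in D `\` An n) cst M'%:E x)%E).
  apply: ae_ge0_le_integral => //.
  - by move=> x _; rewrite lee_fin.
  - by move=> x _; rewrite lee_fin ltW.
  - by apply: filterS phiM' => x phix _; rewrite lee_fin.
rewrite integral_cst//.
have le_bd : (mu (D `\` An n) <= mu (vh_boundary [set (- t)%R] (A n)))%E.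
  by rewrite le_measure// inE//; exact: vh_boundary1_measurable.
have -> : e = M' * (e / M') by rewrite mulrC divfK// gt_eqF.
rewrite EFinM -muleA lee_pmul2l//.
exact: le_trans le_bd (ltW bd_lt).
Qed.

(** Once the means of the q-th power of the modulus fall below the q-th power of [d], the two terms
    of [le_add_powR] contribute [d] each. *)
Lemma mean_le_bnorm q d k : 1 <= q -> 0 < d -> cmeasurable k ->
  (bnorm mu A q k < d%:E)%E -> mean_le (fun x => normc (k x)) (d + d).
Proof.
move=> q1 d0 mk kd.
have q0 : 0 < q by apply: lt_le_trans q1.
have mnk := cmeasurable_normc mk.
have mnkq : measurable_fun [set: borel G] (fun x : borel G => normc (k x) `^ q).
  exact: (measurableT_comp (measurable_powR q) mnk).
have kdq : (limn_esup (fun n =>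
    (\int[mu]_(x in An n) (normc (k x) `^ q)%:E) / mu (A n))
    < (d `^ q)%:E)%E.
  (* Contrapositive: q-th roots are monotone, so a limsup of at least the q-th power of [d] would
     force the seminorm to be at least [d]. *)
  rewrite ltNge; apply/negP => dqk; move: kd; apply/negP; rewrite -leNgt /bnorm.
  have -> : d%:E = ((d `^ q)%:E `^ q^-1)%E.
    by rewrite poweR_EFin -powRrM mulfV ?gt_eqF// powRr1// ltW.
  apply: gt0_ler_poweR => //; first by rewrite invr_ge0 ltW.
    by rewrite in_itv/= leey lee_fin powR_ge0.
  rewrite in_itv/= leey andbT; apply: le_trans dqk; rewrite lee_fin powR_ge0.
  by [].
pose C := (d `^ (q - 1))^-1.
have C0 : 0 <= C by rewrite invr_ge0 powR_ge0.
apply: (@mean_le_mono _ (fun x => d + C * normc (k x) `^ q)) => //.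
- by apply: measurable_funD => //; exact: measurable_funM.
- by move=> x; rewrite normc_ge0/= le_add_powR// normc_ge0.
apply: mean_leD => //.
- exact: measurable_funM.
- by move=> x; exact: ltW.
- by move=> x; rewrite mulr_ge0// powR_ge0.
- exact: mean_le_cst.
apply: filterS (limn_esup_lt kdq) => n.
rewrite [X in (_ / X)%E]vh_EFin inver gt_eqF ?fine_vh_gt0//.
rewrite lte_pdivrMr ?fine_vh_gt0// -vh_EFin => /ltW kn.
under eq_integral do rewrite EFinM.
rewrite ge0_integralZl//; last 3 first.
- exact: vh_measurable.
- by apply: measurable_funTS; exact/measurable_EFinP.
- by move=> x _; rewrite lee_fin powR_ge0.
have -> : d = C * d `^ q.
  by rewrite -(mulr_powRB1 (ltW d0) q0) /C mulrCA mulVf ?mulr1// gt_eqF// powR_gt0.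
by rewrite EFinM -muleA lee_wpmul2l.
Qed.

Lemma integrable_ae_bounded (phi : G -> R) M n : measurable_fun [set: borel G] phi ->
  (\forall x \ae mu, `|phi x| <= M) ->
  mu.-integrable (An n) (EFin \o phi : borel G -> \bar R).
Proof.
move=> mphi phiM; apply/integrableP; split.
  by apply: measurable_funTS; exact/measurable_EFinP.
apply: (@le_lt_trans _ _ (\int[mu]_(x in An n) cst `|M|%:E x)%E).
  apply: ae_ge0_le_integral => //.
  - exact: vh_measurable.
  - apply: measurable_funTS; apply/measurable_EFinP; exact: measurableT_comp.
  - by move=> x _; rewrite lee_fin.
  - by apply: filterS phiM => x phix _; rewrite lee_fin (le_trans phix) ?ler_norm.
rewrite integral_cst; last exact: vh_measurable.
by rewrite lte_mul_pinfty// ltey_eq vh_fin.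
Qed.

(** Integrability of [r] comes out of the estimate itself: domination by [M * psi] makes the
    integral of its absolute value finite. *)
Lemma Rintegral_le_mean (r : G -> R) psi M c n : measurable_fun [set: borel G] r ->
  measurable_fun [set: borel G] psi -> (forall x, 0 <= psi x) -> 0 <= M ->
  (\forall x \ae mu, `|r x| <= M * psi x) ->
  (\int[mu]_(x in An n) (psi x)%:E <= c%:E * mu (A n))%E ->
  `|\int[mu]_(x in An n) r x| <= M * c * fine (mu (A n)).
Proof.
move=> mr mpsi psi0 M0 rpsi psic.
have mr' : measurable_fun (An n) (EFin \o r : borel G -> \bar R).
  by apply: measurable_funTS; exact/measurable_EFinP.
have le_r : (\int[mu]_(x in An n) `|(r x)%:E| <= (M * c * fine (mu (A n)))%:E)%E.
  apply: (@le_trans _ _ (\int[mu]_(x in An n) (M%:E * (psi x)%:E))%E).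
    apply: ae_ge0_le_integral => //.
    - exact: vh_measurable.
    - exact: measurableT_comp mr'.
    - by move=> x _; rewrite -EFinM lee_fin mulr_ge0.
    - apply: measurable_funTS; apply/measurable_EFinP; exact: measurable_funM.
    - by apply: filterS rpsi => x rx _; rewrite -EFinM lee_fin.
  rewrite ge0_integralZl//; last 3 first.
  - exact: vh_measurable.
  - by apply: measurable_funTS; exact/measurable_EFinP.
  - by move=> x _; rewrite lee_fin.
  by rewrite -mulrA EFinM [X in (_ <= _ * X)%E]EFinM -vh_EFin lee_wpmul2l.
have ir : mu.-integrable (An n) (EFin \o r : borel G -> \bar R).
  by apply/integrableP; split => //; apply: le_lt_trans le_r _; rewrite ltry.
apply: le_trans (le_normr_Rintegral (vh_measurable n) ir) _.
rewrite -lee_fin fineK//.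
by rewrite ge0_fin_numE ?integral_ge0//; apply: le_lt_trans le_r _; rewrite ltry.
Qed.

(** The factor 2 arises from bounding the real and imaginary parts of the integral separately, each
    mean by [M * c]. *)
Lemma cintegral_le_mean f k M c n : cmeasurable f -> cmeasurable k ->
  0 <= M -> (\forall x \ae mu, normc (f x) <= M) ->
  (\int[mu]_(x in An n) (normc (k x))%:E <= c%:E * mu (A n))%E ->
  normc (((fine (mu (A n)))^-1)%:C%C * cintegral mu (A n) (fun s => f s * k s))
    <= 2 * M * c.
Proof.
move=> mf mk M0 fM kc.
have m0 := fine_vh_gt0 n.
have [mR mI] := cmeasurableM mf mk.
have fkM : \forall x \ae mu, normc (f x * k x) <= M * normc (k x).
  by apply: filterS fM => x fM; rewrite Normc.normcM ler_wpM2r// normc_ge0.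
have bR : \forall x \ae mu, `|complex.Re (f x * k x)| <= M * normc (k x).
  by apply: filterS fkM => x; apply: le_trans; exact: normRe_le_normc.
have bI : \forall x \ae mu, `|complex.Im (f x * k x)| <= M * normc (k x).
  by apply: filterS fkM => x; apply: le_trans; exact: normIm_le_normc.
have mnk := cmeasurable_normc mk.
have k0 x : 0 <= normc (k x) by exact: normc_ge0.
have RM := Rintegral_le_mean mR mnk k0 M0 bR kc.
have IM := Rintegral_le_mean mI mnk k0 M0 bI kc.
rewrite Normc.normcM normc_real gtr0_norm ?invr_gt0// ler_pdivrMl//.
apply: le_trans (normc_le_ReIm _) _; rewrite /cintegral/=.
apply: le_trans (lerD RM IM) _.
by lra.
Qed.

(** Essentially bounded products are integrable over [A n], which has finite measure, so the
    integral may be split. *)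
Lemma cintegralB f k1 k2 M n : cmeasurable f -> cmeasurable k1 -> cmeasurable k2 ->
  (\forall x \ae mu, normc (f x * k1 x) <= M) ->
  (\forall x \ae mu, normc (f x * k2 x) <= M) ->
  cintegral mu (A n) (fun s => f s * (k1 s - k2 s)) =
  cintegral mu (A n) (fun s => f s * k1 s) - cintegral mu (A n) (fun s => f s * k2 s).
Proof.
move=> mf mk1 mk2 fk1 fk2.
have [mR1 mI1] := cmeasurableM mf mk1; have [mR2 mI2] := cmeasurableM mf mk2.
have iR k :
    measurable_fun [set: borel G] (fun x : borel G => complex.Re (f x * k x)) ->
    (\forall x \ae mu, normc (f x * k x) <= M) ->
    mu.-integrable (An n) 
      (EFin \o (fun x => complex.Re (f x * k x)) : borel G -> \bar R).
  move=> mR fk; apply: (@integrable_ae_bounded _ M) => //.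
  by apply: filterS fk => x; apply: le_trans; exact: normRe_le_normc.
have iI k :
    measurable_fun [set: borel G] (fun x : borel G => complex.Im (f x * k x)) ->
    (\forall x \ae mu, normc (f x * k x) <= M) ->
    mu.-integrable (An n) 
      (EFin \o (fun x => complex.Im (f x * k x)) : borel G -> \bar R).
  move=> mI fk; apply: (@integrable_ae_bounded _ M) => //.
  by apply: filterS fk => x; apply: le_trans; exact: normIm_le_normc.
rewrite /cintegral -[RHS]/(_ +i* _)%C; congr (_ +i* _)%C.
  rewrite -RintegralB; [|exact: vh_measurable|exact: iR|exact: iR].
  by apply: eq_Rintegral => x _; rewrite mulrBr;
  case: (f x * k1 x); case: (f x * k2 x).
rewrite -RintegralB; [|exact: vh_measurable|exact: iI|exact: iI].
by apply: eq_Rintegral => x _; rewrite mulrBr;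
  case: (f x * k1 x); case: (f x * k2 x).
Qed.

End Means.

Lemma normc_limnB_le {R : realType} (u v : nat -> R[i]^o) (c : R) :
  cvgn u -> cvgn v -> (\forall n \near \oo, normc (u n - v n) <= c) ->
  normc (limn u - limn v) <= c.
Proof.
move=> cu cv uvc; apply/ler_addgt0Pr => e e0.
have e2 : 0 < e / 2 by rewrite divr_gt0.
have near_lim (w : nat -> R[i]^o) : cvgn w ->
    \forall n \near \oo, normc (limn w - w n) < e / 2.
  move=> cw; have e2C : 0 < ((e / 2)%:C)%C :> R[i] by rewrite ltcR.
  have /cvgrPdist_lt/(_ _ e2C) := cw; apply: filterS => n.
  by rewrite -[`|_|]/((normc (limn w - w n))%:C)%C ltcR.
have [n [[un vn] uvn]] :=
  filter_ex (filterI (filterI (near_lim _ cu) (near_lim _ cv)) uvc).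
rewrite (splitr e) addrA; apply: le_trans (normc_dist_add (v n) _ _) _.
rewrite lerD//; last by rewrite normc_distC ltW.
apply: le_trans (normc_dist_add (u n) _ _) _.
by rewrite addrC lerD// ltW.
Qed.

(** * Variation of the twisted convolution under a shift of its argument *)

Section TwistedEberlein.
Context {R : realType} {G : topologicalZmodType}.
Variable mu : {measure set (borel G) -> \bar R}.
Variable A : nat -> set G.
Hypothesis mu_haar : is_haar mu.
Hypothesis A_van_hove : van_hove mu A.
Implicit Types (f g h k : G -> R[i]) (t u : G).

(** A bound of at least 1 is positive, so that a precision can later be divided by it. *)
Lemma Linfty_ae_bounded f : Linfty mu f ->
  exists2 M : R, 1 <= M & \forall x \ae mu, normc (f x) <= M.
Proof.
move=> [_ fb].
have [M fM] := @ess_supr_bounded _ _ _ mu (fun x : borel G => normc (f x)) fb.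
exists (Num.max M 1); first by rewrite le_max lexx orbT.
by apply: filterS fM => x fM; rewrite le_max fM.
Qed.

(** The difference of two means is the mean of [f] times a difference of conjugated translates of
    [g]. The bound [M'] secures integrability of the products; the final constant involves [M] and
    [c] alone. *)
Lemma twisted_eberlein_dist f g t t' M M' c : cmeasurable f -> cmeasurable g ->
  0 <= M -> (\forall x \ae mu, normc (f x) <= M) ->
  (\forall x \ae mu, normc (g x) <= M') ->
  twisted_eberlein_exists mu A f g ->
  mean_le mu A (fun x => normc (g (x - t) - g (x - t'))) c ->
  normc (twisted_eberlein mu A f g t - twisted_eberlein mu A f g t') <= 2 * M * c.
Proof.
move=> mf mg M0 fM gM' fg gc.
apply: normc_limnB_le; [exact: fg|exact: fg|].
have mgt s : cmeasurable (fun x => conjc (g (x - s))).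
  exact: (cmeasurable_conjc (cmeasurable_translate s mg)).
have fgb s : \forall x \ae mu, normc (f x * conjc (g (x - s))) <= M * M'.
  apply: filterS2 fM (ae_translate mu_haar s gM') => x fM gM.
  by rewrite Normc.normcM ler_pM ?normc_ge0// normc_conjc.
have mgtt' := cmeasurableB (mgt t) (mgt t').
apply: filterS gc => n gc.
rewrite /eberlein_mean.
have := @cintegral_le_mean _ _ mu A mu_haar A_van_hove f _ M c n mf mgtt' M0 fM.
rewrite (@cintegralB _ _ mu A mu_haar A_van_hove f _ _ (M * M'))// mulrBr; apply.
by under eq_integral do rewrite -conjcB normc_conjc.
Qed.

(** Passing through [h (x - (t + u))] and [h (x - t)] gives three terms. The outer ones cost 2 d
    each, the middle one c, and translating each of the three costs another d. No hypothesis
    involves [t], so the bound is uniform in it. *)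
Lemma mean_le_translateB g h t u d c M M' :
  cmeasurable g -> cmeasurable h -> 0 < d ->
  (\forall x \ae mu, normc (g x) <= M) -> (forall x, normc (h x) <= M') ->
  mean_le mu A (fun x => normc (g x - h x)) (d + d) ->
  mean_le mu A (fun x => normc (h x - h (x - u))) c ->
  mean_le mu A (fun x => normc (g (x - (t + u)) - g (x - t))) (c + 7 * d).
Proof.
move=> mg mh d0 gM hM gh hc.
have mB k k' s s' : cmeasurable k -> cmeasurable k' ->
    measurable_fun [set: borel G]
      (fun x : borel G => normc (k (x - s) - k' (x - s'))).
  move=> mk mk'.
  exact: (cmeasurable_normc (cmeasurableB (cmeasurable_translate s mk)
    (cmeasurable_translate s' mk'))).
have mgh : measurable_fun [set: borel G] (fun x : borel G => normc (g x - h x)).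
  exact: (cmeasurable_normc (cmeasurableB mg mh)).
have mhh : measurable_fun [set: borel G]
    (fun x : borel G => normc (h x - h (x - u))).
  exact: (cmeasurable_normc (cmeasurableB mh (cmeasurable_translate u mh))).
have ghM : \forall x \ae mu, normc (g x - h x) <= M + M'.
  apply: filterS gM => x gM; apply: le_trans (normc_dist_add 0 _ _) _.
  by rewrite subr0 sub0r normcN lerD.
have hhM : \forall x \ae mu, normc (h x - h (x - u)) <= M' + M'.
  near=> x; apply: le_trans (normc_dist_add 0 _ _) _.
  by rewrite subr0 sub0r normcN lerD.
have gh1 := mean_le_translate mu_haar A_van_hove (t + u) mgh
  (fun x => normc_ge0 _) ghM d0 gh.
have gh2 := mean_le_translate mu_haar A_van_hove t mgh
  (fun x => normc_ge0 _) ghM d0 gh.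
have hh := mean_le_translate mu_haar A_van_hove t mhh
  (fun x => normc_ge0 _) hhM d0 hc.
have mgh1 := mB _ _ (t + u) (t + u) mg mh.
have mgh2 := mB _ _ t t mg mh.
have mhh1 : measurable_fun [set: borel G]
    (fun x : borel G => normc (h (x - t) - h (x - t - u))).
  exact: measurableT_comp mhh (@measurable_addr G (- t)).
have S1 := mean_leD mu_haar A_van_hove mhh1 mgh2
  (fun x => normc_ge0 _) (fun x => normc_ge0 _) hh gh2.
have S2 := mean_leD mu_haar A_van_hove mgh1
  (measurable_funD mhh1 mgh2) (fun x => normc_ge0 _)
  (fun x => addr_ge0 (normc_ge0 _) (normc_ge0 _)) gh1 S1.
have -> : c + 7 * d = d + d + d + (c + d + (d + d + d)) by lra.
apply: mean_le_mono S2 => //.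
- exact: mB.
- by apply: measurable_funD => //; apply: measurable_funD.
move=> x; rewrite normc_ge0/=.
apply: le_trans (normc_dist_add (h (x - (t + u))) _ _) _; rewrite lerD//.
apply: le_trans (normc_dist_add (h (x - t)) _ _) _.
by rewrite lerD// normc_distC// opprD addrA.
Unshelve. all: by end_near.
Qed.

End TwistedEberlein.

(** * Almost periodicity of the twisted convolution *)

Theorem theorem3p18 (R : realType) (G : topologicalZmodType)
  (G_hausdorff : hausdorff_space G)
  (G_locally_compact : locally_compact [set: G])
  (G_second_countable : @second_countable G)
  (mu : {measure set (borel G) -> \bar R}) (mu_haar : is_haar mu)
  (A : nat -> set G) (A_van_hove : van_hove mu A)
  (p q : R) (p_gt1 : 1 < p) (q_gt1 : 1 < q) (pq : p^-1 + q^-1 = 1)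
  (f g : G -> R[i])
  (f_BL : BL mu A p f) (f_Linfty : Linfty mu f)
  (g_Map : Map mu A q g) (g_Linfty : Linfty mu g)
  (fg_exists : twisted_eberlein_exists mu A f g) :
  SAP (twisted_eberlein mu A f g).
Proof.
have [mf _] := f_Linfty; have [mg _] := g_Linfty.
have [M M1 fM] := Linfty_ae_bounded f_Linfty.
have [M' _ gM'] := Linfty_ae_bounded g_Linfty.
have M0 : 0 < M by apply: lt_le_trans M1.
(* Increments of the convolution are controlled, uniformly in [t], by the mean oscillation of a
   function [h] chosen before [t] and [u]. *)
have approx e : 0 < e -> exists h d, [/\ MAP mu A h, 0 < d &
    forall t u, mean_le mu A (fun x => normc (h x - h (x - u))) (d + d) ->
      normc (twisted_eberlein mu A f g (t + u) -
             twisted_eberlein mu A f g t) < e].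
  (* The estimates below add up to 2 M (2 d + 7 d) = 18 M d, which is less than 20 M d = e. *)
  move=> e0; pose d := e / (20 * M).
  have d0 : 0 < d by rewrite divr_gt0// mulr_gt0.
  have [h hMAP ghd] := g_Map.2 d d0.
  have [[[M'' hM''] uch] _] := hMAP.
  have mh := unif_cont_cmeasurable uch.
  exists h, d; split=> // t u hu.
  have gh := mean_le_bnorm mu_haar A_van_hove (ltW q_gt1) d0
    (cmeasurableB mg mh) ghd.
  have gtu := mean_le_translateB mu_haar A_van_hove t mg mh d0 gM' hM'' gh hu.
  apply: le_lt_trans
    (twisted_eberlein_dist mu_haar A_van_hove mf mg (ltW M0) fM gM' fg_exists gtu) _.
  have -> : 2 * M * (d + d + 7 * d) = 18 / 20 * e.
    by rewrite /d; field; rewrite gt_eqF.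
  by lra.
apply: bohr_SAP => e e0.
  (* Uniform continuity: for small [u] the difference [h y - h (y - u)] has modulus below d at every
     y, and so its means are at most d + d. *)
  have [h [d [[[_ uch] _] d0 hd]]] := approx e e0.
  apply: filterS (uch _ d0) => u hu x; apply: hd.
  have mh := unif_cont_cmeasurable uch.
  apply: (mean_le_mono A_van_hove (psi := cst (d + d))) => //.
  - exact: (cmeasurable_normc (cmeasurableB mh (cmeasurable_translate u mh))).
  - move=> y; rewrite normc_ge0/=; have := hu (y - u); rewrite subrK => /ltW.
    by move=> /le_trans; apply; rewrite lerDl ltW.
  - exact: mean_le_cst.
(* Bohr's condition: the almost periods of [h] for the seminorm [bnorm 1] and the precision [d] are
   sup-norm almost periods of the convolution, by [mean_le_bnorm] with exponent 1, so the same
   compact [K] works. *)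
have [h [d [[[_ uch] hap] d0 hd]]] := approx e e0.
have [K Kc KS] := hap d d0; exists K => //.
apply/seteqP; split => // t _; have : [set: G] t by [].
rewrite -KS => -[s sS [k Kk <-]]; exists s; last by exists k.
(* Writing [x] as (x - s) + s brings the difference into the form required by [hd], with t = x - s
   and u = s. *)
move=> x /=; rewrite normc_distC -{1}[x](subrK s); apply: hd.
have mh := unif_cont_cmeasurable uch.
apply: mean_le_bnorm sS => //.
exact: (cmeasurableB mh (cmeasurable_translate s mh)).
Qed.
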